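(* There exists a constant $C>0$ such that the following holds. Let $n$ and $m$ be integers with $n>0$ and $2n-3\le m\le\binom{n}{2}$. Then there exists a parametrically weighted graph with $n$ vertices and $m$ edges that has at least $C\,m\log n$ distinct parametric minimum spanning trees.
   Context: A parametrically weighted graph is a connected undirected graph each of whose edges is labeled with a linear function of a real parameter $\lambda$. For each value of $\lambda$, evaluating these functions gives real edge weights and hence minimum spanning trees. The parametric minimum spanning trees are the distinct spanning trees occurring in the sequence of minimum spanning trees obtained as $\lambda$ varies continuously from $-\infty$ to $\infty$ (each being a minimum spanning tree throughout some range of $\lambda$). *)

(* Defs.v *)
From mathcomp Require Import all_boot all_order all_algebra.
From mathcomp Require Import reals exp.

Set Implicit Arguments.
Unset Strict Implicit.
Unset Printing Implicit Defensive.

Import Order.TTheory GRing.Theory Num.Theory.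
Local Open Scope ring_scope.

(* In a graph on the vertex set 'I_n an edge is a two-element set of vertices,
   and a set of edges F is identified with the spanning subgraph ('I_n, F). *)
Section EdgeSets.
Variable n : nat.
Implicit Type F : {set {set 'I_n}}.

Definition adjacent F : rel 'I_n := [rel u v | (u != v) && ([set u; v] \in F)].

Definition connected_graph F : Prop := forall u v, connect (adjacent F) u v.

Definition acyclic_graph F : Prop :=
  forall s : seq 'I_n, (2 < size s)%N -> ~ ucycle (adjacent F) s.

End EdgeSets.

(* The label of the edge e is the linear function
   x |-> slope e * x + intercept e; the values of slope and intercept outside
   edges are irrelevant. *)
Record pwgraph (R : realType) (n : nat) := PWGraph {
  edges : {set {set 'I_n}};
  edges_card2 : forall e, e \in edges -> #|e| = 2%N;
  edges_connected : connected_graph edges;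
  slope : {set 'I_n} -> R;
  intercept : {set 'I_n} -> R
}.

Section ParametricMST.
Variables (R : realType) (n : nat) (G : pwgraph R n).
Implicit Type T : {set {set 'I_n}}.

Definition edge_weight (x : R) (e : {set 'I_n}) : R :=
  slope G e * x + intercept G e.

Definition tree_weight (x : R) T : R := \sum_(e in T) edge_weight x e.

Definition spanning_tree T : Prop :=
  [/\ T \subset edges G, connected_graph T & acyclic_graph T].

Definition minimum_spanning_tree (x : R) T : Prop :=
  spanning_tree T /\
  forall T', spanning_tree T' -> tree_weight x T <= tree_weight x T'.

(* Ts lists the successive minimum spanning trees as x goes from -oo to +oo,
   and bs the values of x at which the tree changes: the i-th tree is minimum
   throughout the i-th of the closed intervals into which bs cuts the line
   (the first and last ones being unbounded).  The equivalence also says that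
   the i-th tree is minimum nowhere else: a tree is replaced only when it
   ceases to be minimum.  Hence trees that remain tied throughout an interval
   (for instance when several edges carry the same label) contribute a single
   tree to the sequence. *)
Definition parametric_mst_sequence (Ts : seq {set {set 'I_n}}) : Prop :=
  exists bs : seq R,
    [/\ sorted <%R bs,
        size Ts = (size bs).+1 &
        forall (i : nat) (x : R), (i < size Ts)%N ->
          minimum_spanning_tree x (nth set0 Ts i) <->
          ((0 < i)%N -> bs`_i.-1 <= x) /\ ((i < size bs)%N -> x <= bs`_i)].

End ParametricMST.

(* Main.v *)
Require Import Defs.
From mathcomp Require Import all_boot all_order all_algebra.
From mathcomp Require Import boolp reals exp.
From mathcomp Require Import zify ring lra.

(* Replacing every edge e of a graph by a triangle whose third vertex is new gives a
   graph in which e behaves like a single edge of weight min(a, max(b, c)), where a is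
   the weight of the side parallel to e and b, c are those of the other two sides.
   Choosing a, b, c to be tiny rescaled copies of the weight of e, superposed on three
   fixed lines whose min-max follows b, then c, then a, the new graph runs three times
   through the tree sequence of the old one. At the passage from c to a, each edge of
   the current tree moreover causes a change of its own. So i iterations from a single
   edge give 3^i edges and of the order of i 3^i changes.

   Each new vertex has only two neighbours when it is added, so the vertices can be
   labelled greedily, with labels O(3^i), such that all edges have distinct lengths.
   Then the translates of the graph are edge-disjoint, and a complete graph on n
   vertices contains about n copies of a graph with about n edges. The copies are made
   active in turn by adding to the j-th one the tangent at j to the concave function
   -x^2: near j, this copy is lighter than all other edges. *)

Set Implicit Arguments.
Unset Strict Implicit.
Unset Printing Implicit Defensive.

Import Order.TTheory GRing.Theory Num.Theory.
Local Open Scope ring_scope.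

(** * Spanning trees and cuts *)

Section Colourings.
Variable n : nat.
Implicit Types (T F : {set {set 'I_n}}) (e f : {set 'I_n}) (chi psi : 'I_n -> bool).

(** The edge [e] crosses the cut whose two sides are the colour classes of [chi]. *)
Definition flip chi e := [exists a in e, exists b in e, chi a != chi b].

Lemma flip2 chi a b : flip chi [set a; b] = (chi a != chi b).
Proof.
apply/idP/idP => [/exists_inP[x + /exists_inP[y]]|ab].
  by rewrite !inE => /orP[]/eqP-> /orP[]/eqP->; rewrite ?eqxx // eq_sym.
apply/exists_inP; exists a; first by rewrite !inE eqxx.
by apply/exists_inP; exists b; rewrite ?inE ?eqxx ?orbT.
Qed.

Lemma flip_addb chi psi e : #|e| = 2%N ->
  flip (fun x => chi x (+) psi x) e = flip chi e (+) flip psi e.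
Proof.
move/eqP/cards2P => [a [b [_ ->]]]; rewrite !flip2.
by case: (chi a) (chi b) (psi a) (psi b) => [] [] [] [].
Qed.

(** For a spanning tree [T], this is the fundamental cut of its edge [f]. *)
Definition cut_of T f chi :=
  flip chi f /\ forall g, g \in T -> g != f -> ~~ flip chi g.

(** Spanning trees without paths or cycles: the first clause is connectivity, the second acyclicity.
    Colourings can be added modulo 2, which makes exchanges easy. *)
Definition tree_cuts T :=
  (forall chi, (forall f, f \in T -> ~~ flip chi f) -> forall u v, chi u = chi v)
  /\ (forall f, f \in T -> exists chi, cut_of T f chi).

Lemma adjacent_sym T : symmetric (adjacent T).
Proof. by move=> x y; rewrite /adjacent /= eq_sym setUC. Qed.

Lemma connect_flip T chi u v :
  (forall f, f \in T -> ~~ flip chi f) -> connect (adjacent T) u v ->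
  chi u = chi v.
Proof.
move=> nf /connectP[p + ->]; elim: p u => //= x p IH u /andP[ux px].
rewrite -(IH x px); case/andP: ux => _ /nf; rewrite flip2 => /negbNE.
by move/eqP.
Qed.

Lemma connect_noflip T u f : #|f| = 2%N -> f \in T ->
  ~~ flip (connect (adjacent T) u) f.
Proof.
move=> /eqP/cards2P[a [b [ab ->]]] fT; rewrite flip2 negbK; apply/eqP.
apply: same_connect1r; first exact/sym_connect_sym/adjacent_sym.
by rewrite /adjacent /= ab fT.
Qed.

Lemma connected_graph_flip T : (forall e, e \in T -> #|e| = 2%N) ->
  connected_graph T <->
  forall chi, (forall f, f \in T -> ~~ flip chi f) -> forall u v, chi u = chi v.
Proof.
move=> T2; split=> [cT chi nf u v|H u v]; first exact: connect_flip (cT u v).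
rewrite -(H (connect (adjacent T) u) _ u v) ?connect0 // => f fT.
by apply: connect_noflip => //; apply: T2.
Qed.

(** In a forest, the component of one end of [f] after deleting [f] is a cut for [f]. Conversely, a
    cycle through [f] crosses every cut an even number of times, so it cannot cross one in [f]
    alone. *)
Lemma acyclic_graph_cuts T : (forall e, e \in T -> #|e| = 2%N) ->
  acyclic_graph T <-> forall f, f \in T -> exists chi, cut_of T f chi.
Proof.
move=> T2; split=> [aT f fT|H].
  have /eqP/cards2P[a [b [ab fE]]] := T2 f fT.
  exists (connect (adjacent (T :\ f)) a); split; last first.
    by move=> g gT gf; apply: connect_noflip; [exact: T2 | rewrite !inE gf].
  rewrite fE flip2 connect0 eq_sym eqb_id; apply/negP => /connectP[p].
  rewrite -fE => pp bE; move: ab fE; rewrite bE; clear bE b.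
  case/shortenP: pp => {}p pp up _ ab fE.
  (* A simple path avoiding [f] between its ends closes up with [f]; it has at least two edges,
     being neither empty nor [f] itself. *)
  apply: (aT (a :: p)).
    case: p pp up ab fE => [|c [|d p]] //=; first by rewrite eqxx.
    by rewrite /adjacent /= => + _ _ fE; rewrite -fE !inE eqxx andbF.
  rewrite /ucycle up andbT /= rcons_path; apply/andP; split.
    apply: sub_path pp => x y; rewrite /adjacent /= => /andP[->].
    by rewrite !inE => /andP[_ ->].
  by rewrite /adjacent /= eq_sym ab setUC -fE.
move=> [|x [|y [|z r]]] // _ /andP[] /= /and3P[/andP[xy fT] /andP[yz gT] zr].
rewrite !inE !negb_or => /and4P[/and3P[_ xz xr] /andP[_ yr] _ _].
have [chi [ff nf]] := H _ fT.
have cyz : chi y = chi z.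
  apply/eqP; rewrite -[_ == _]negbK -flip2; apply: nf => //.
  apply/eqP => /setP/(_ x); rewrite !inE eqxx /= (negPf xy).
  by rewrite (negPf xz).
move: ff; rewrite flip2 cyz; apply/negP; rewrite negbK eq_sym; apply/eqP.
rewrite -[in RHS](last_rcons z r x).
(* The rest of the cycle avoids [y], hence never uses the edge from [x] to [y], and the colour stays
   constant from [z] back to [x]. *)
have : y \notin rcons r x by rewrite mem_rcons inE negb_or eq_sym xy yr.
elim: (rcons r x) z yz zr {gT cyz xz} => //= c p IH z yz.
move=> /andP[/andP[zc gT] cp]; rewrite inE negb_or => /andP[yc yp].
rewrite -(IH c) //; apply/eqP; rewrite -[_ == _]negbK -flip2; apply: nf => //.
apply/eqP => /setP/(_ y); rewrite !inE eqxx orbT.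
by rewrite (negPf yz) (negPf yc).
Qed.

(** A connected subset of least cardinality works: an edge with no cut of its own could be
    deleted. *)
Lemma tree_cuts_exists (E : {set {set 'I_n}}) : (forall e, e \in E -> #|e| = 2%N) ->
  connected_graph E -> exists2 T : {set {set 'I_n}}, T \subset E & tree_cuts T.
Proof.
move=> E2 cE.
pose P (T : {set {set 'I_n}}) := (T \subset E) && `[< connected_graph T >].
have PE : P E by rewrite /P subxx; apply/asboolP.
case: (arg_minnP (fun T : {set {set 'I_n}} => #|T|) PE) => T /andP[TE /asboolP cT] Tmin.
have T2 e : e \in T -> #|e| = 2%N by move/(subsetP TE)/E2.
exists T => //; split; first exact/connected_graph_flip.
move=> f fT; apply/not_existsP => nc.
suff /Tmin : P (T :\ f) by rewrite (cardsD1 f T) fT ltnn.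
rewrite /P (subset_trans (subsetDl _ _) TE); apply/asboolP.
have T2' e : e \in T :\ f -> #|e| = 2%N by rewrite !inE => /andP[_ /T2].
apply/connected_graph_flip => // chi nf u v.
apply: (proj1 (connected_graph_flip T2) cT) => g gT.
have [->|gf] := eqVneq g f; last by apply: nf; rewrite !inE gf.
apply/negP => ff; apply: (nc chi); split=> // h hT hf; apply: nf.
by rewrite !inE hf.
Qed.

(** The cut [psi] of [f] becomes the cut of [e]. A cut of another tree edge is kept if it misses
    [e], and otherwise corrected by adding [psi] modulo 2. *)
Lemma tree_cuts_exchange T f e psi : (forall g, g \in T -> #|g| = 2%N) ->
  #|e| = 2%N -> tree_cuts T -> f \in T -> e \notin T -> cut_of T f psi ->
  flip psi e -> tree_cuts (e |: T :\ f).
Proof.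
move=> T2 e2 [cT aT] fT eT [ff fn] fe; split.
  move=> chi nf; have ce : ~~ flip chi e by apply: nf; rewrite !inE eqxx.
  have cg g : g \in T -> g != f -> ~~ flip chi g.
    by move=> gT gf; apply: nf; rewrite !inE gf gT orbT.
  case cf: (flip chi f); last first.
    by apply: cT => g gT; have [->|gf] := eqVneq g f; [rewrite cf | exact: cg].
  (* Now [chi] and [psi] flip the same tree edge, so they agree up to complement, although only
     [psi] flips [e]. *)
  have H : forall u v, chi u (+) psi u = chi v (+) psi v.
    apply: cT => g gT; rewrite flip_addb; last exact: T2.
    have [->|gf] := eqVneq g f; first by rewrite cf ff.
    by rewrite (negPf (cg _ gT gf)) (negPf (fn _ gT gf)).
  move/eqP/cards2P: e2 => [a [b [_ eE]]]; move: ce fe; rewrite eE !flip2.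
  by move: (H a b); case: (chi a) (chi b) (psi a) (psi b) => [] [] [] [].
move=> g; rewrite !inE => /orP[/eqP->|/andP[gf gT]].
  exists psi; split=> // h; rewrite !inE => /orP[/eqP->|/andP[hf hT _]].
    by rewrite eqxx.
  exact: fn.
have [chi [cg nc]] := aT g gT.
have [ce|ce] := boolP (flip chi e); last first.
  exists chi; split=> // h; rewrite !inE => /orP[/eqP->//|/andP[hf hT hg]].
  exact: nc.
exists (fun x => chi x (+) psi x); split.
  by rewrite flip_addb ?T2 // cg (negPf (fn _ gT gf)).
move=> h; rewrite !inE => /orP[/eqP->|/andP[hf hT hg]].
  by rewrite flip_addb // ce fe.
by rewrite flip_addb ?T2 // (negPf (nc _ hT hg)) (negPf (fn _ hT hf)).
Qed.

(* The cuts of the tree edges generate all colourings modulo constants, so one of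
   those occurring in chi flips e. *)
Lemma tree_cuts_path T e chi : (forall g, g \in T -> #|g| = 2%N) ->
  #|e| = 2%N -> tree_cuts T -> flip chi e ->
  exists f psi, [/\ f \in T, flip chi f, cut_of T f psi & flip psi e].
Proof.
move=> T2 e2 [cT aT].
have [k] := ubnP #|[set f in T | flip chi f]|; elim: k chi => // k IH chi ck ce.
have [f fT cf] : exists2 f, f \in T & flip chi f.
  apply/not_exists2P => H; move: ce; move/eqP/cards2P: e2 => [a [b [_ ->]]].
  rewrite flip2; apply/negP; rewrite negbK; apply/eqP/cT => f fT.
  by apply/negP => cf; case: (H f).
have [psi [pf pn]] := aT f fT.
have [pe|pe] := boolP (flip psi e); first by exists f, psi.
have [||g [phi [gT cg g1 g2]]] := IH (fun x => chi x (+) psi x).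
- rewrite -ltnS; apply: leq_ltn_trans ck; apply: proper_card.
  apply/properP; split.
    apply/subsetP => g; rewrite !inE => /andP[gT].
    rewrite gT flip_addb ?T2 //; have [->|gf] := eqVneq g f; first by rewrite cf.
    by rewrite (negPf (pn _ gT gf)) addbF.
  by exists f; rewrite !inE fT // flip_addb ?T2 // cf pf.
- by rewrite flip_addb // ce (negPf pe).
exists g, phi; split=> //; move: cg; rewrite flip_addb ?T2 //.
have [->|gf] := eqVneq g f; first by rewrite cf.
by rewrite (negPf (pn _ gT gf)) addbF.
Qed.

End Colourings.

(** * Cut and cycle properties of minimum spanning trees *)

Section MST.
Variables (R : realType) (n : nat) (G : pwgraph R n).
Implicit Types (T : {set {set 'I_n}}) (x : R).

Lemma spanning_treeP T :
  spanning_tree G T <-> T \subset edges G /\ tree_cuts T.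
Proof.
split=> [[TE cT aT]|[TE [cT aT]]].
  have T2 e : e \in T -> #|e| = 2%N by move/(subsetP TE)/(@edges_card2 _ _ G).
  split=> //; split; [exact/connected_graph_flip | exact/acyclic_graph_cuts].
have T2 e : e \in T -> #|e| = 2%N by move/(subsetP TE)/(@edges_card2 _ _ G).
by split=> //; [exact/connected_graph_flip | exact/acyclic_graph_cuts].
Qed.

Lemma spanning_tree_exists : exists T, spanning_tree G T.
Proof.
have [T TE cT] := tree_cuts_exists (@edges_card2 _ _ G) (@edges_connected _ _ G).
by exists T; apply/spanning_treeP.
Qed.

Lemma mst_exchange x T f e psi : minimum_spanning_tree G x T -> f \in T ->
  e \in edges G -> e \notin T -> cut_of T f psi -> flip psi e ->
  edge_weight G x f <= edge_weight G x e.
Proof.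
move=> [/spanning_treeP[TE tT] Tmin] fT eE eT cf pe.
have T2 g : g \in T -> #|g| = 2%N by move/(subsetP TE)/(@edges_card2 _ _ G).
have e2 := edges_card2 eE.
have tT' := tree_cuts_exchange T2 e2 tT fT eT cf pe.
have /Tmin : spanning_tree G (e |: T :\ f).
  apply/spanning_treeP; split=> //; apply/subsetP => g.
  rewrite !inE => /orP[/eqP->//|/andP[_]]; exact: (subsetP TE).
rewrite /tree_weight big_setU1 /=; last by rewrite !inE (negPf eT) andbF.
by rewrite (big_setD1 f) //= lerD2r.
Qed.

(** A strictly lighter edge across the fundamental cut of [e] could replace [e]. *)
Lemma mst_mem x T e : minimum_spanning_tree G x T -> e \in T ->
  exists2 chi, flip chi e &
    forall f, f \in edges G -> edge_weight G x f < edge_weight G x e ->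
      ~~ flip chi f.
Proof.
move=> mT eT; have [/spanning_treeP[TE tT] _] := mT.
have [psi ce] := tT.2 e eT; exists psi; first exact: ce.1.
move=> f fE fe; apply/negP => pf.
have [fT|fT] := boolP (f \in T).
  have ne : f != e by apply: contraTneq fe => ->; rewrite ltxx.
  by move/negP: (ce.2 _ fT ne); apply.
by have := mst_exchange mT eT fE fT ce pf; rewrite leNgt fe.
Qed.

(** The colouring separates the ends of [e], so it cuts an edge of the tree path joining them; that
    edge is not heavier, since [e] could replace it. *)
Lemma mst_notin x T e chi : minimum_spanning_tree G x T -> e \in edges G ->
  e \notin T -> flip chi e ->
  exists f, [/\ f \in edges G, f != e, flip chi f &
                edge_weight G x f <= edge_weight G x e].
Proof.
move=> mT eE eT ce; have [/spanning_treeP[TE tT] _] := mT.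
have T2 g : g \in T -> #|g| = 2%N by move/(subsetP TE)/(@edges_card2 _ _ G).
have [f [psi [fT cf cutf pe]]] := tree_cuts_path T2 (edges_card2 eE) tT ce.
exists f; split=> //; first exact: (subsetP TE).
  by apply: contraTneq fT => ->.
exact: mst_exchange mT fT eE eT cutf pe.
Qed.

End MST.

(** * Lower envelope of finitely many lines *)

Lemma family_bound (R : realFieldType) (J : finType) (F : J -> R) :
  exists2 B, 0 < B & forall j, `|F j| <= B.
Proof.
exists (1 + \sum_j `|F j|) => [|j].
  by rewrite ltr_pwDl ?ltr01 // sumr_ge0.
rewrite (bigD1 j) //= addrCA lerDl addr_ge0 ?ler01 //; exact: sumr_ge0.
Qed.

Lemma ex_argmin (R : realFieldType) (Q : finType) (P : pred Q) (F : Q -> R) q0 :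
  P q0 -> exists2 q, P q & forall q', P q' -> F q <= F q'.
Proof.
by move=> Pq0; have [q Pq mq] := @arg_minP _ R Q q0 P F Pq0; exists q.
Qed.

Section LowerEnvelope.
Variables (R : realFieldType) (Q : finType) (P : pred Q) (s c : Q -> R).

Let L q x := s q * x + c q.

Definition lowest x q := P q /\ forall q', P q' -> L q x <= L q' x.

(** Comparison with the lines of at least the same slope ([up]) persists as [x] grows; comparison
    with those of smaller slope ([low]) holds up to the first crossing. *)
Let up x q := forall q', P q' -> s q <= s q' -> L q x <= L q' x.
Let low x q := forall q', P q' -> s q' < s q -> L q x <= L q' x.
Let cross q q' := (c q' - c q) / (s q - s q').

Let crossP q q' x : s q' < s q -> (L q x <= L q' x) = (x <= cross q q').
Proof.
move=> lt; have d0 : 0 < s q - s q' by rewrite subr_gt0.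
rewrite /cross ler_pdivlMr // /L; apply/idP/idP; lra.
Qed.

Let cross_ltP q q' x : s q' < s q -> (L q x < L q' x) = (x < cross q q').
Proof.
move=> lt; have d0 : 0 < s q - s q' by rewrite subr_gt0.
rewrite /cross ltr_pdivlMr // /L; apply/idP/idP; lra.
Qed.

Let lowestE x q : P q -> up x q -> low x q -> lowest x q.
Proof.
move=> Pq uq lq; split=> // q' Pq'.
by case: (leP (s q) (s q')) => [/uq|/lq]; apply.
Qed.

(** Follows the envelope to the right from its current line [q], by induction on the number of lines
    of smaller slope. [Ts] lists the lines after [q], and each starts at the break of the same
    index. *)
Lemma envelope_from k q b0 :
  (#|[set q' | P q' & (s q' < s q)%R]| < k)%N -> P q ->
  (forall x, b0 < x -> up x q) ->
  (forall q', P q' -> s q' < s q -> b0 < cross q q') ->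
  exists bs Ts, [/\ path <%R b0 bs, size Ts = size bs,
    forall x, low x q <-> ((0 < size bs)%N -> x <= bs`_0) &
    forall i x, (i < size Ts)%N ->
      lowest x (nth q Ts i) <->
      bs`_i <= x /\ ((i.+1 < size bs)%N -> x <= bs`_i.+1)].
Proof.
elim: k q b0 => // k IH q b0 ck Pq uq lq.
have [/existsP[q0 /andP[Pq0 lt0]]|/existsPn nq] :=
  boolP [exists q', P q' && (s q' < s q)]; last first.
  exists [::], [::]; split=> // x; split=> // _ q' Pq' lt'.
  by case/negP: (nq q'); rewrite Pq'.
(* The next break is the first crossing of [q] with a line of smaller slope. *)
have [|q1 /andP[Pq1 lt1] min1] :=
  @ex_argmin _ _ [pred q' | P q' && (s q' < s q)] (cross q) q0.
  by rewrite /= Pq0.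
set b1 := cross q q1 in min1.
have b01 : b0 < b1 by apply: lq.
have lowP x : low x q <-> x <= b1.
  split=> [lx|xb q' Pq' lt']; first by rewrite -crossP //; apply: lx.
  by rewrite crossP // (le_trans xb) // min1 //= Pq'.
have mq : lowest b1 q by apply: lowestE; [|apply: uq|apply/lowP].
have Hq1 : P q1 && (L q1 b1 == L q b1).
  rewrite Pq1; apply/eqP; rewrite /b1 /L /cross; field.
  by rewrite subr_eq0 gt_eqF.
clearbody b1.
(* Of the lines meeting [q] at the break, the one of least slope continues the envelope; all its
   further crossings then lie strictly to the right. *)
have [q2 /andP[Pq2 /eqP E2] min2] :=
  @ex_argmin _ _ [pred q' | P q' && (L q' b1 == L q b1)] s q1 Hq1.
have lt2 : s q2 < s q by apply: le_lt_trans (min2 _ Hq1) lt1.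
have mq2 : lowest b1 q2 by split=> // q' /(mq.2); rewrite E2.
have uq2 x : b1 <= x -> up x q2.
  move=> bx q' Pq' le'; have := mq2.2 q' Pq'; rewrite /L; nra.
have [|||bs [Ts [pbs sTs l2 mTs]]] := IH q2 b1 _ Pq2.
- rewrite -ltnS; apply: leq_trans ck; rewrite ltnS; apply: proper_card.
  apply/properP; split.
    by apply/subsetP => q'; rewrite !inE => /andP[-> /lt_trans]; apply.
  by exists q2; rewrite !inE Pq2 //= ltxx.
- by move=> x /ltW; apply: uq2.
- move=> q' Pq' lt'; rewrite -cross_ltP // lt_neqAle mq2.2 // andbT; apply: contraTneq lt' => E'.
  by rewrite -leNgt min2 //= Pq' -E' E2 eqxx.
exists (b1 :: bs), (q2 :: Ts); split=> /=; rewrite ?b01 ?sTs //.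
  by move=> x; rewrite lowP; split=> [? _|]; last by apply.
case=> [|i] x /= ilt; last first.
  have lt : (i < size Ts)%N by rewrite sTs.
  by rewrite (set_nth_default q2) // mTs.
rewrite ltnS -l2; split=> [[_ mx]|[bx lx]].
  split=> [|q' Pq' _]; last exact: mx.
  have := mx q Pq; move: E2; rewrite /L => E2; nra.
by apply: lowestE => //; apply: uq2.
Qed.

Lemma lower_envelope q0 : P q0 ->
  exists (bs : seq R) (Ts : seq Q), [/\ sorted <%R bs, size Ts = (size bs).+1 &
    forall i x, (i < size Ts)%N ->
      lowest x (nth q0 Ts i) <->
      ((0 < i)%N -> bs`_i.-1 <= x) /\ ((i < size bs)%N -> x <= bs`_i)].
Proof.
move=> Pq0.
(* Near minus infinity the lowest line has the largest slope and, among those, the least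
   intercept. *)
have [q1 Pq1 max1] := ex_argmin (fun q => - s q) Pq0.
have [|q2 /andP[Pq2 /eqP E2] min2] :=
  @ex_argmin _ _ [pred q' | P q' && (s q' == s q1)] c q1.
  by rewrite /= Pq1 eqxx.
have uq2 x : up x q2.
  move=> q' Pq' le'.
  have E' : s q' = s q1 by apply: le_anti; rewrite -lerN2 max1 //= -E2.
  by rewrite /L E2 E' lerD2l min2 //= Pq' E' eqxx.
have [B B0 HB] := family_bound (cross q2).
(* The starting point lies to the left of every crossing with [q2]. *)
have [||bs [Ts [pbs sTs l2 mTs]]] := @envelope_from _ q2 (- B - 1) (ltnSn _) Pq2.
- by [].
- move=> q' _ _; have := HB q'; rewrite ler_norml => /andP[]; lra.
exists bs, (q2 :: Ts); split; rewrite /= ?sTs //; first exact: path_sorted pbs.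
case=> [|i] x /= ilt; last first.
  rewrite (set_nth_default q2) ?sTs // mTs ?sTs //.
  by split=> -[H1 H2]; split=> //; apply: H1.
rewrite -l2; split=> [[_ mx]|[_ lx]].
  by split=> // q' Pq' _; apply: mx.
exact: lowestE.
Qed.

End LowerEnvelope.

(** * Counting parametric minimum spanning trees *)

Section Counting.
Variables (R : realType) (n : nat) (G : pwgraph R n).
Implicit Types (T : {set {set 'I_n}}) (x : R).

Lemma tree_weightE x T :
  tree_weight G x T = (\sum_(e in T) slope G e) * x + \sum_(e in T) intercept G e.
Proof. by rewrite /tree_weight /edge_weight big_split /= mulr_suml. Qed.

(** The difference of two tree weights is affine in the parameter. *)
Lemma mst_convex x y z T : x <= y <= z ->
  minimum_spanning_tree G x T -> minimum_spanning_tree G z T ->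
  minimum_spanning_tree G y T.
Proof.
move=> /andP[xy yz] [sT mx] [_ mz]; split=> // T' sT'.
move: (mx _ sT') (mz _ sT'); rewrite !tree_weightE.
move: (\sum_(e in T) slope G e) (\sum_(e in T) intercept G e) => a b.
move: (\sum_(e in T') slope G e) (\sum_(e in T') intercept G e) => a' b'.
case: (leP a a') => aa; nra.
Qed.

Lemma mst_sequence_exists : exists Ts : seq {set {set 'I_n}},
  parametric_mst_sequence G Ts /\
  forall x, exists2 T, T \in Ts & minimum_spanning_tree G x T.
Proof.
pose P T := `[< spanning_tree G T >].
have lowestP x T : minimum_spanning_tree G x T <->
    lowest P (fun T => \sum_(e in T) slope G e)
      (fun T => \sum_(e in T) intercept G e) x T.
  split=> [[sT mT]|[/asboolP sT mT]].
    split=> [|T' /asboolP sT']; first exact/asboolP.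
    by rewrite -!tree_weightE; apply: mT.
  by split=> // T' sT'; rewrite !tree_weightE; apply: mT; apply/asboolP.
have [T0 /asboolP PT0] := spanning_tree_exists G.
have [bs [Ts [sbs szT mTs]]] := @lower_envelope _ _ P
  (fun T => \sum_(e in T) slope G e) (fun T => \sum_(e in T) intercept G e) T0 PT0.
have mst i x : (i < size Ts)%N -> minimum_spanning_tree G x (nth set0 Ts i) <->
    ((0 < i)%N -> bs`_i.-1 <= x) /\ ((i < size bs)%N -> x <= bs`_i).
  by move=> iTs; rewrite (set_nth_default T0) // lowestP mTs.
exists Ts; split; first by exists bs; split.
move=> x; pose i := find (fun b => x <= b) bs.
have iTs : (i < size Ts)%N by rewrite szT ltnS find_size.
exists (nth set0 Ts i); first exact: mem_nth.
apply/mst => //; split=> [i0|ibs]; last first.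
  by apply: (@nth_find _ 0 (fun b => x <= b)); rewrite has_find.
have : (i.-1 < i)%N by rewrite prednK.
by move=> /(before_find 0)/negbT; rewrite -ltNge => /ltW.
Qed.

(* The order of the two pairs is left open because [window_pair] reverses it. *)
Definition disj (p q : R * R) := (p.2 <= q.1) || (q.2 <= p.1).

(* By convexity, a tree that is minimum at the right ends of two disjoint pairs is
   minimum on the whole of the later pair. *)
Lemma mst_count (ps : seq (R * R)) : pairwise disj ps ->
  (forall p, p \in ps -> p.1 < p.2 /\
     forall T, minimum_spanning_tree G p.1 T -> ~ minimum_spanning_tree G p.2 T) ->
  exists Ts : seq {set {set 'I_n}},
    parametric_mst_sequence G Ts /\ (maxn 1 (size ps) <= size (undup Ts))%N.
Proof.
move=> dps Hps; have [Ts [sTs cTs]] := mst_sequence_exists.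
exists Ts; split=> //; rewrite geq_max; apply/andP; split.
  have [T + _] := cTs 0; rewrite -mem_undup; by case: (undup Ts).
have /choice[tau Htau] : forall x, exists T, T \in Ts /\ minimum_spanning_tree G x T.
  by move=> x; have [T] := cTs x; exists T.
rewrite -(size_map (fun p => tau p.2)); apply: uniq_leq_size; last first.
  by move=> T /mapP[p _ ->]; rewrite mem_undup; case: (Htau p.2).
rewrite uniq_pairwise pairwise_map.
apply: (sub_in_pairwise (P := [in ps]) _ _ dps); last exact/allP.
move=> p q /= pps qps; have [p12 Hp] := Hps p pps; have [q12 Hq] := Hps q qps.
have [_ mp] := Htau p.2; have [_ mq] := Htau q.2.
case/orP=> pq; apply/eqP => E.
  apply: (Hq (tau q.2)) => //; rewrite -E in mq *.
  by apply: mst_convex mp mq; rewrite pq ltW.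
apply: (Hp (tau p.2)) => //; rewrite E in mp *.
by apply: mst_convex mq mp; rewrite pq ltW.
Qed.

End Counting.

(** * Triangle replacement *)

(* When the weights are distinct, [kru w] is the set of edges chosen by Kruskal's
   algorithm; expressing this by colourings avoids paths altogether. *)
Section Kruskal.
Variables (R : realDomainType) (I : finType) (V : Type) (u v : I -> V).

(** Says that [p] and [q] lie in different components of the graph with edge set [F]. *)
Definition separated (F : pred I) (p q : V) := exists2 chi : V -> bool,
  forall f, F f -> chi (u f) = chi (v f) & chi p != chi q.

Definition kru (w : I -> R) : {set I} :=
  [set e | `[< separated (fun f => w f < w e) (u e) (v e) >]].

Lemma kruP w e :
  reflect (separated (fun f => w f < w e) (u e) (v e)) (e \in kru w).
Proof. by rewrite inE; apply: asboolP. Qed.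

Lemma separated_sub (F F' : pred I) p q : (forall f, F' f -> F f) ->
  separated F p q -> separated F' p q.
Proof. by move=> sub [chi H1 H2]; exists chi => // f /sub/H1. Qed.

Lemma kru_mono w w' : injective w -> (forall e f, w e < w f -> w' e < w' f) ->
  kru w' = kru w.
Proof.
move=> wi ww'; have E e f : (w' e < w' f) = (w e < w f).
  apply/idP/idP => [lt'|]; last exact: ww'.
  case: (ltgtP (w e) (w f)) => // [/ww'|/wi E]; first by rewrite ltNge ltW.
  by rewrite E ltxx in lt'.
by apply/setP => e; apply/kruP/kruP; apply: separated_sub => f; rewrite E.
Qed.

End Kruskal.

Section Triangles.
Variables (R : realDomainType) (I : finType) (V : finType) (u v : I -> V).

(** In the triangle of [e], [None] is the side parallel to [e], and [Some false] and [Some true]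
    join [u e] and [v e] to the new vertex [inr e]. *)
Definition tri_u (oe : option bool * I) : V + I :=
  inl (if oe.1 is Some true then v oe.2 else u oe.2).
Definition tri_v (oe : option bool * I) : V + I :=
  if oe.1 is Some _ then inr oe.2 else inl (v oe.2).

Variable w : option bool * I -> R.

Definition tri_min e :=
  Num.min (w (None, e)) (Num.max (w (Some false, e)) (w (Some true, e))).

Let K' := kru tri_u tri_v w.
Let K := kru u v tri_min.

(** [tri_min e] is the bottleneck weight between the ends of [e] in its triangle. To extend a
    colouring, the new vertex takes the colour of [u e] if the side to it is below the threshold,
    and that of [v e] otherwise. *)
Lemma tri_separated t p q :
  separated tri_u tri_v (fun f => w f < t) (inl p) (inl q) <->
  separated u v (fun f => tri_min f < t) p q.
Proof.
split=> [[chi H pq]|[chi H pq]].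
  exists (chi \o inl) => // e; rewrite /tri_min gt_min gt_max.
  case/orP=> [lt|/andP[lt1 lt2]]; first exact: (H (None, e)).
  by rewrite /= (H (Some false, e)) // -(H (Some true, e)).
exists (fun x => match x with inl p => chi p
  | inr e => if w (Some false, e) < t then chi (u e) else chi (v e) end) => //.
case=> [[[]|] e] lt //=.
- case: ifP => // lt'; apply/esym/H.
  by rewrite /tri_min gt_min gt_max lt lt' orbT.
- by rewrite lt.
- by apply: H; rewrite /tri_min gt_min lt.
Qed.

(** Only two edges cross the cut around the new vertex, and this is the lighter one. *)
Lemma tri_small d e : w (Some (~~ d), e) < w (Some d, e) ->
  (Some (~~ d), e) \in K'.
Proof.
move=> lt; apply/kruP.
exists (fun x => if x is inr f then f == e else false); last first.
  by rewrite /= eqxx.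
move=> [[d'|] f] //= ltf; apply/esym/negbTE; apply: contraTN ltf => /eqP->.
by rewrite -leNgt; case: d d' lt => [] [] //= /ltW.
Qed.

Lemma tri_big_max d e : w (Some (~~ d), e) < w (Some d, e) ->
  tri_min e = Num.min (w (None, e)) (w (Some d, e)).
Proof.
move=> lt; rewrite /tri_min; congr Num.min; case: d lt => /= lt.
  by rewrite max_r // ltW.
by rewrite max_l // ltW.
Qed.

(** The heaviest side of a triangle is rejected. Here it is a side at the new vertex, so the
    parallel side has weight [tri_min e] and plays the role of [e]. *)
Lemma tri_direct d e : w (Some (~~ d), e) < w (Some d, e) ->
  w (None, e) < w (Some d, e) ->
  ((None, e) \in K') = (e \in K) /\ (Some d, e) \notin K'.
Proof.
move=> lt1 lt2; have E : tri_min e = w (None, e).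
  by rewrite (tri_big_max lt1) min_l // ltW.
split.
  apply/kruP/kruP; rewrite E; exact: (proj1 (tri_separated _ _ _)) ||
    exact: (proj2 (tri_separated _ _ _)).
apply/negP => /kruP[chi H]; rewrite /tri_u /tri_v /=.
move: (H (Some (~~ d), e) lt1) (H (None, e) lt2); rewrite /tri_u /tri_v /=.
by case: d {H lt1 lt2} => /= -> ->; rewrite eqxx.
Qed.

Lemma tri_path d e : w (Some (~~ d), e) < w (Some d, e) ->
  w (Some d, e) < w (None, e) ->
  (None, e) \notin K' /\ ((Some d, e) \in K') = (e \in K).
Proof.
move=> lt1 lt2; have E : tri_min e = w (Some d, e).
  by rewrite (tri_big_max lt1) min_r // ltW.
split.
  apply/negP => /kruP[chi H]; rewrite /tri_u /tri_v /=.
  move: (H (Some (~~ d), e) (lt_trans lt1 lt2)) (H (Some d, e) lt2).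
  rewrite /tri_u /tri_v /=.
  by case: d {H E lt1 lt2} => /= -> ->; rewrite eqxx.
(* The lighter side at the new vertex gives that vertex the colour of one end of [e], so splitting
   the other side amounts to splitting [e]. *)
apply/kruP/kruP; rewrite E.
  case=> chi H ce; apply/tri_separated; exists chi => //.
  move: ce (H (Some (~~ d), e) lt1); rewrite /tri_u /tri_v /=.
  case: d {H lt1 lt2 E} => /= ce ce'; first by rewrite ce' eq_sym.
  by rewrite ce'.
move/tri_separated => [chi H ce]; exists chi => //.
move: ce (H (Some (~~ d), e) lt1); rewrite /tri_u /tri_v /=.
by case: d {H lt1 lt2 E} => /= ce <- //; rewrite eq_sym.
Qed.

(** The old tree can be read off from the new one, so every change of the old tree is a change of
    the new one. *)
Lemma tri_kru : injective w -> forall e, (e \in K) =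
  ((None, e) \in K') || ((Some false, e) \in K') && ((Some true, e) \in K').
Proof.
move=> wi e.
have [d lt1] : exists d, w (Some (~~ d), e) < w (Some d, e).
  case: (ltgtP (w (Some false, e)) (w (Some true, e))) => [||/wi //].
    by exists true.
  by exists false.
have -> : ((Some false, e) \in K') && ((Some true, e) \in K') =
    ((Some d, e) \in K').
  by have := tri_small lt1; case: (d) => /= ->; rewrite ?andbT.
case: (ltgtP (w (None, e)) (w (Some d, e))) => [lt2|lt2|/wi //].
  by have [-> /negPf->] := tri_direct lt1 lt2; rewrite orbF.
by have [/negPf-> ->] := tri_path lt1 lt2.
Qed.

(** Each triangle contributes the lighter side at its new vertex. This keeps a third of all edges in
    the tree, whose individual changes drive the next iteration. *)
Lemma card_tri_kru : (forall e, w (Some false, e) != w (Some true, e)) ->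
  (#|I| <= #|K'|)%N.
Proof.
move=> wi.
have /choice[d Hd] : forall e, exists d, (Some d, e) \in K'.
  move=> e; have := wi e.
  case: (ltgtP (w (Some false, e)) (w (Some true, e))) => // lt _.
    by exists false; apply: (@tri_small true).
  by exists true; apply: (@tri_small false).
rewrite -cardsT -(card_imset _ (f := fun e => (Some (d e), e))); last by move=> e f [].
by apply/subset_leq_card/subsetP => _ /imsetP[e _ ->].
Qed.

End Triangles.

(** * Weights for the triangle replacement *)

Lemma family_gap (R : realFieldType) (J : finType) (F : J -> R) :
  exists2 d, 0 < d & forall j, F j != 0 -> d < `|F j|.
Proof.
(* Where [F j] is 0 its inverse is 0 too, so no case distinction is needed for the bound. *)
have [B B0 HB] := family_bound (fun j => (F j)^-1).
exists (B + 1)^-1 => [|j Fj]; first by rewrite invr_gt0 addr_gt0.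
rewrite invf_plt ?posrE ?normr_gt0 ?addr_gt0 // -normfV.
by apply: le_lt_trans (HB j) _; rewrite ltrDl.
Qed.

Lemma disj_cat (R : realType) (t : R) (s1 s2 : seq (R * R)) :
  pairwise (@disj R) s1 -> pairwise (@disj R) s2 ->
  (forall p, p \in s1 -> p.2 <= t) -> (forall p, p \in s2 -> t <= p.1) ->
  pairwise (@disj R) (s1 ++ s2).
Proof.
move=> d1 d2 H1 H2; rewrite pairwise_cat d1 d2 !andbT; apply/allrelP => p q ps qs.
by rewrite /disj (le_trans (H1 p ps) (H2 q qs)).
Qed.

Definition line (R : realFieldType) (I : Type) (s c : I -> R) (x : R) (e : I) :=
  s e * x + c e.

(** Distinct weights at both ends make the Kruskal set there the actual tree. *)
Definition kru_changes (R : realType) (I : finType) (V : Type) (u v : I -> V)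
    (s c : I -> R) (p : R * R) :=
  [/\ p.1 < p.2, injective (line s c p.1), injective (line s c p.2) &
      kru u v (line s c p.1) <> kru u v (line s c p.2)].

Section TriangleWeights.
Variables (R : realType) (I V : finType) (u v : I -> V) (s c : I -> R) (L eps : R).
Hypotheses (L0 : 0 < L) (eps0 : 0 < eps) (s_inj : injective s).
Hypothesis large_mono :
  forall x, L <= x -> forall e f, s e < s f -> line s c x e < line s c x f.
Hypothesis large_inj : forall x, L <= `|x| -> injective (line s c x).
Hypothesis eps_small :
  forall e (y : R), `|y| <= 4 -> `|eps * line s c (8 * L * y) e| <= 1 / 100.

(* The base lines make min(a, max(b, c)) equal to b, c and a near x = -1, 1/2 and 2.
   There the sides run through the original weights on the window [-L, L]; side a does
   so backwards, so that at the passage from c to a (near x = 1) both sides order the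
   edges by slope. *)
Definition tri_base (o : option bool) (x : R) : R :=
  match o with None => 3 - 2 * x | Some false => - x | Some true => x end.
Definition tri_arg (o : option bool) (x : R) : R :=
  match o with None => 2 - x | Some false => x + 1 | Some true => x - 1 / 2 end.

(** Slope and intercept of [tri_base o x + eps * line s c (8 * L * tri_arg o x) e]. The factor
    [8 * L] shrinks the old window from [-L] to [L] to length 1/4. *)
Definition tri_s (oe : option bool * I) : R :=
  match oe.1 with
  | None => - 2 - eps * (8 * L) * s oe.2
  | Some false => - 1 + eps * (8 * L) * s oe.2
  | Some true => 1 + eps * (8 * L) * s oe.2
  end.
Definition tri_c (oe : option bool * I) : R :=
  match oe.1 with
  | None => 3 + eps * (8 * L * 2 * s oe.2 + c oe.2)
  | Some false => eps * (8 * L * s oe.2 + c oe.2)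
  | Some true => eps * (c oe.2 - 8 * L * (1 / 2) * s oe.2)
  end.

Let W := line tri_s tri_c.
Let pert o x e := eps * line s c (8 * L * tri_arg o x) e.

Lemma tri_lineE o e x : W x (o, e) = tri_base o x + pert o x e.
Proof.
rewrite /W /pert /line /tri_s /tri_c /tri_base /tri_arg /=.
by case: o => [[]|]; ring.
Qed.

Let arg_le o (x : R) : - 2 <= x <= 3 -> `|tri_arg o x| <= 4.
Proof. by move=> /andP[x1 x2]; rewrite ler_norml; case: o => [[]|] /=; lra. Qed.

Let pert_le o (x : R) e : - 2 <= x <= 3 -> - (1 / 100) <= pert o x e <= 1 / 100.
Proof. by move=> Hx; rewrite -ler_norml; apply/eps_small/arg_le. Qed.

Let pert_inj o x : injective (line s c (8 * L * tri_arg o x)) -> injective (pert o x).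
Proof. by move=> H e f /(mulfI (lt0r_neq0 eps0))/H. Qed.

Let pert_large o x : 1 / 8 <= `|tri_arg o x| -> injective (pert o x).
Proof.
move=> H; apply/pert_inj/large_inj; rewrite normrM gtr0_norm ?mulr_gt0 //.
have := ler_wpM2l (ltW L0) H; lra.
Qed.

(** Perturbations are at most 1/100, so base lines more than 1/50 apart keep different kinds of
    sides distinct. *)
Let W_inj (x : R) : - 2 <= x <= 3 -> (forall o, injective (pert o x)) ->
  (forall o o', o != o' -> 1 / 50 < `|tri_base o x - tri_base o' x|) ->
  injective (W x).
Proof.
move=> Hx inj gap [o e] [o' f]; rewrite !tri_lineE.
have [<-|/gap] := eqVneq o o'; first by move=> /addrI/inj->.
have := pert_le o e Hx; have := pert_le o' f Hx.
move: (pert o x e) (pert o' x f) (tri_base o x) (tri_base o' x) => a b a' b' Ha Hb.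
by rewrite ltr_normr => /orP[] H1 H2; exfalso; lra.
Qed.

Let W_changes x y : x < y -> injective (W x) -> injective (W y) ->
  kru u v (tri_min (W x)) <> kru u v (tri_min (W y)) ->
  kru_changes (tri_u u v) (tri_v v) tri_s tri_c (x, y).
Proof.
move=> xy ix iy nK; split=> //= EK; apply: nK; apply/setP => e.
by rewrite (tri_kru u v ix) (tri_kru u v iy) EK.
Qed.

Let scaleK t : 8 * L * (t / (8 * L)) = t.
Proof. by rewrite mulrC divfK // mulf_neq0 // ?pnatr_eq0 // lt0r_neq0. Qed.

Let scale_le (t : R) : - L <= t <= L -> - (1 / 8) <= t / (8 * L) <= 1 / 8.
Proof.
have K0 : 0 < 8 * L by rewrite mulr_gt0.
by move=> /andP[t1 t2]; rewrite ler_pdivlMr // ler_pdivrMr //; lra.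
Qed.

(** The new parameter at which side [o] sees the old parameter [t]. *)
Definition window (o : option bool) (t : R) : R :=
  match o with None => 2 - t / (8 * L) | Some false => - 1 + t / (8 * L)
  | Some true => 1 / 2 + t / (8 * L) end.

Let window_arg o t : tri_arg o (window o t) = t / (8 * L).
Proof. by case: o => [[]|]; rewrite /tri_arg /window; ring. Qed.

Let window_bound o (t : R) : - L <= t <= L -> - 2 <= window o t <= 3.
Proof.
by move=> /scale_le; case: o => [[]|]; rewrite /window; move: (t / _) => y; lra.
Qed.

Let window_inj o (t : R) : - L <= t <= L -> injective (line s c t) ->
  injective (W (window o t)).
Proof.
move=> Ht it; apply: W_inj; first exact: window_bound.
  move=> o'; have [->|no] := eqVneq o' o.
    by apply: pert_inj; rewrite window_arg scaleK.
  apply: pert_large; rewrite ler_normr.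
  move: (scale_le Ht) no; rewrite /window /tri_arg; move: (t / _) => y Hy.
  by case: o o' => [[]|] [[]|] //= _; lra.
move=> o1 o2; rewrite ltr_normr; move: (scale_le Ht); rewrite /window.
move: (t / _) => y Hy.
by case: o => [[]|]; case: o1 o2 => [[]|] [[]|] //= _; rewrite /tri_base; lra.
Qed.

(** At -1, 1/2 and 2 the base values (a, b, c) are (5, 1, -1), (2, -1/2, 1/2) and (-1, -2, 2). The
    min-max is b, c and a respectively, by margins that survive the perturbations. *)
Let window_min o (t : R) e : - L <= t <= L ->
  tri_min (W (window o t)) e = tri_base o (window o t) + eps * line s c t e.
Proof.
move=> Ht; have -> : eps * line s c t e = pert o (window o t) e.
  by rewrite /pert window_arg scaleK.
move: (scale_le Ht) (fun o' => pert_le o' e (window_bound o Ht)).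
rewrite /tri_min !tri_lineE; set y := t / _ => Hy Hp.
move: (Hp None) (Hp (Some true)) (Hp (Some false)).
case: o {Hp} => [[]|]; rewrite /tri_base /window -/y;
  move: (pert None _ e) (pert (Some true) _ e) (pert (Some false) _ e) =>
  p1 p2 p3 Ha Hb Hc.
- by rewrite max_r ?min_r //; lra.
- by rewrite max_l ?min_r //; lra.
- by rewrite max_r ?min_l //; lra.
Qed.

Let window_kru o (t : R) : - L <= t <= L -> injective (line s c t) ->
  kru u v (tri_min (W (window o t))) = kru u v (line s c t).
Proof.
move=> Ht it; apply: kru_mono => // e f ef.
by rewrite !window_min // ltrD2l ltr_pM2l.
Qed.

Definition window_pair o (p : R * R) :=
  if o is None then (window o p.2, window o p.1) else (window o p.1, window o p.2).

Let in_range (p : R * R) := - L <= p.1 <= L /\ - L <= p.2 <= L.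

Lemma window_changes o p : in_range p -> kru_changes u v s c p ->
  kru_changes (tri_u u v) (tri_v v) tri_s tri_c (window_pair o p).
Proof.
move=> [H1 H2] [p12 i1 i2 nK].
have lt : p.1 / (8 * L) < p.2 / (8 * L) by rewrite ltr_pM2r // invr_gt0 mulr_gt0.
have K1 := window_kru o H1 i1; have K2 := window_kru o H2 i2.
have I1 := @window_inj o _ H1 i1; have I2 := @window_inj o _ H2 i2.
case: o K1 K2 I1 I2 => [[]|] K1 K2 I1 I2; apply: W_changes => //;
  rewrite ?K1 ?K2 //; first [exact: nesym | by rewrite /window; lra].
Qed.

Lemma window_disj o ps : pairwise (@disj R) ps ->
  pairwise (@disj R) (map (window_pair o) ps).
Proof.
rewrite pairwise_map; apply: sub_pairwise => p q; rewrite /disj /=.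
have K0 : 0 < (8 * L)^-1 by rewrite invr_gt0 mulr_gt0.
have le a b : (a / (8 * L) <= b / (8 * L)) = (a <= b) by rewrite ler_pM2r.
rewrite -(le p.2) -(le q.2).
by case: o => [[]|] /orP[] H; apply/orP; rewrite /window_pair /window /=; lra.
Qed.

Lemma window_range o p : in_range p ->
  match o with None => 15 / 8 <= (window_pair o p).1
  | Some true => 3 / 8 <= (window_pair o p).1 /\ (window_pair o p).2 <= 5 / 8
  | Some false => (window_pair o p).2 <= - (7 / 8) end.
Proof.
by move=> [/scale_le H1 /scale_le H2]; case: o => [[]|]; rewrite /window_pair /window /=; lra.
Qed.

Let sg e := eps * (8 * L) * s e.
(** The parameter where the sides [None] and [Some true] of [e] have equal weight; the intercept of
    [e] cancels. *)
Definition tri_cross e := (3 + 5 / 2 * sg e) / (3 + 2 * sg e).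

Let sg_le e : - (1 / 50) <= sg e <= 1 / 50.
Proof.
have := eps_small e (y := 1); have := eps_small e (y := 0).
rewrite normr0 normr1 /line !mulr0 mulr1 /= add0r !ler_norml => H0 H1.
have := H0 ltac:(lra); have := H1 ltac:(lra); rewrite /sg.
have -> : eps * (s e * (8 * L) + c e) = eps * (8 * L) * s e + eps * c e by ring.
by move: (eps * (8 * L) * s e) (eps * c e) => a b; lra.
Qed.

Let cross_den e : 0 < 3 + 2 * sg e.
Proof. by have := sg_le e; lra. Qed.

Lemma tri_cross_near e : 99 / 100 <= tri_cross e <= 101 / 100.
Proof.
by rewrite ler_pdivlMr // ler_pdivrMr //; have := sg_le e; lra.
Qed.

Lemma tri_cross_inj : injective tri_cross.
Proof.
move=> e f /eqP; rewrite eqr_div ?lt0r_neq0 // => /eqP E.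
have {E} : sg e = sg f by lra.
by move=> /mulfI H; apply/s_inj/H; rewrite mulf_neq0 // ?lt0r_neq0 ?mulr_gt0.
Qed.

Lemma tri_crossE e d : W (tri_cross e + d) (Some true, e) - W (tri_cross e + d) (None, e)
  = (3 + 2 * sg e) * d.
Proof.
rewrite /W /line /tri_s /tri_c /= /tri_cross /sg; field.
by rewrite -/(sg e) lt0r_neq0.
Qed.

Lemma tri_s_inj : injective tri_s.
Proof.
move=> [o e] [o' f]; rewrite /tri_s /= -/(sg e) -/(sg f) => E.
have sgI : sg e = sg f -> e = f.
  by move=> /mulfI H; apply/s_inj/H; rewrite mulf_neq0 // ?lt0r_neq0 ?mulr_gt0.
have := sg_le e; have := sg_le f.
by case: o o' E => [[]|] [[]|] E H1 H2;
  first [by clear sgI; exfalso; lra | by rewrite (sgI (ltac:(clear sgI; lra)))].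
Qed.

Lemma zone_bounds e (x : R) : 9 / 10 <= x <= 11 / 10 ->
  W x (Some false, e) < W x (Some true, e).
Proof.
move=> Hx; have H2 : - 2 <= x <= 3 by lra.
rewrite !tri_lineE; have := pert_le (Some false) e H2.
have := pert_le (Some true) e H2; rewrite /tri_base; lra.
Qed.

(** Near 1 both relevant sides see old parameters beyond [L], where weights are ordered as slopes;
    so is their minimum. *)
Lemma zone_kru (x : R) : 9 / 10 <= x <= 11 / 10 ->
  kru u v (tri_min (W x)) = kru u v s.
Proof.
move=> Hx; apply: kru_mono => // e f ef.
have mono o : o != Some false -> W x (o, e) < W x (o, f).
  move=> no; rewrite !tri_lineE ltrD2l ltr_pM2l //; apply: large_mono => //.
  have H : 1 / 8 <= tri_arg o x by case: o no => [[]|] // _; rewrite /tri_arg; lra.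
  by have := ler_wpM2l (ltW L0) H; lra.
have E g : tri_min (W x) g = Num.min (W x (None, g)) (W x (Some true, g)).
  by rewrite (@tri_big_max _ _ _ true) //; apply: zone_bounds.
by rewrite !E lt_min !gt_min !mono // orbT.
Qed.

(** As [e] lies in the tree ordered by slope, its parallel side enters the new tree exactly when it
    becomes lighter than the side [Some true]. *)
Lemma zone_changes e (d : R) : 0 < d -> d <= 1 / 100 -> e \in kru u v s ->
  injective (W (tri_cross e - d)) -> injective (W (tri_cross e + d)) ->
  kru_changes (tri_u u v) (tri_v v) tri_s tri_c (tri_cross e - d, tri_cross e + d).
Proof.
move=> d0 d1 es i1 i2; have Hc := tri_cross_near e; split=> //=; first by lra.
have z1 : 9 / 10 <= tri_cross e - d <= 11 / 10 by lra.
have z2 : 9 / 10 <= tri_cross e + d <= 11 / 10 by lra.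
have b1 := zone_bounds e z1; have b2 := zone_bounds e z2.
have dd : 0 < (3 + 2 * sg e) * d by rewrite mulr_gt0.
have lt1 : W (tri_cross e - d) (Some true, e) < W (tri_cross e - d) (None, e).
  by rewrite -subr_lt0 tri_crossE; lra.
have lt2 : W (tri_cross e + d) (None, e) < W (tri_cross e + d) (Some true, e).
  by rewrite -subr_gt0 tri_crossE.
have [n1 _] := @tri_path _ _ _ u v _ true e b1 lt1.
have [n2 _] := @tri_direct _ _ _ u v _ true e b2 lt2.
by move=> E; move: n1; rewrite /W E -/(W _) n2 zone_kru // es.
Qed.

End TriangleWeights.

Lemma pairs_bound (R : realFieldType) (ps : seq (R * R)) :
  exists2 B, 0 < B & forall p, p \in ps -> `|p.1| <= B /\ `|p.2| <= B.
Proof.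
elim: ps => [|q ps [B B0 HB]]; first by exists 1.
exists (B + `|q.1| + `|q.2|) => [|p].
  by rewrite !ltr_wpDr.
have q1 := normr_ge0 q.1; have q2 := normr_ge0 q.2.
by rewrite inE => /orP[/eqP->|/HB[]]; lra.
Qed.

Section TriangleStep.
Variables (R : realType) (I V : finType) (u v : I -> V) (s c : I -> R).
Variable ps : seq (R * R).
Hypothesis s_inj : injective s.
Hypothesis ps_disj : pairwise (@disj R) ps.
Hypothesis ps_changes : forall p, p \in ps -> kru_changes u v s c p.

(** [L] exceeds in absolute value all crossings of two lines and all ends of the given pairs. *)
Let large_param : exists L, [/\ 0 < L,
  (forall x, L <= x -> forall e f, s e < s f -> line s c x e < line s c x f),
  (forall x, L <= `|x| -> injective (line s c x)) &
  (forall p, p \in ps -> - L <= p.1 <= L /\ - L <= p.2 <= L)].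
Proof.
have [B1 B10 H1] := family_bound (fun ef => (c ef.2 - c ef.1) / (s ef.1 - s ef.2)).
have [B2 B20 H2] := pairs_bound ps.
exists (B1 + B2 + 1); split; first by lra.
- move=> x Lx e f ef; have := H1 (e, f); rewrite /= ler_norml => /andP[_].
  rewrite -opprB -[s e - s f]opprB invrN mulrNN ler_pdivrMr ?subr_gt0 // /line => H.
  have Lx' : B1 < x by lra.
  have : B1 * (s f - s e) < x * (s f - s e) by rewrite ltr_pM2r // subr_gt0.
  lra.
- move=> x Lx e f; rewrite /line => E; apply/eqP.
  apply: contraTT Lx => ef; rewrite -ltNge.
  have -> : x = (c f - c e) / (s e - s f).
    by apply: (canRL (mulfK _)); [rewrite subr_eq0 (inj_eq s_inj) | lra].
  by have := H1 (e, f); rewrite /=; lra.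
by move=> p /H2[]; rewrite !ler_norml; lra.
Qed.

Lemma triangle_step : exists (s' c' : option bool * I -> R) (ps' : seq (R * R)),
  [/\ injective s', pairwise (@disj R) ps',
     forall p, p \in ps' -> kru_changes (tri_u u v) (tri_v v) s' c' p,
     size ps' = (3 * size ps + #|kru u v s|)%N &
     (#|I| <= #|kru (tri_u u v) (tri_v v) s'|)%N].
Proof.
have [L [L0 L_mono L_inj L_ps]] := large_param.
(* With [|y|] at most 4, the old parameter [8 * L * y] is at most [32 * L] in absolute value. *)
have [B B0 HB] := family_bound (fun e => `|s e| * (32 * L) + `|c e|).
pose eps := (100 * B)^-1.
have eps0 : 0 < eps by rewrite invr_gt0 mulr_gt0.
have eps_small e (y : R) : `|y| <= 4 -> `|eps * line s c (8 * L * y) e| <= 1 / 100.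
  move=> y4; have -> : 1 / 100 = eps * B by rewrite /eps; field; apply: lt0r_neq0.
  rewrite normrM gtr0_norm // ler_pM2l //.
  apply: le_trans (HB e); apply: le_trans (ler_norm _).
  apply: le_trans (ler_normD _ _) _; rewrite lerD2r normrM ler_wpM2l //.
  rewrite normrM gtr0_norm ?mulr_gt0 //.
  have := ler_wpM2l (ltW L0) y4; lra.
pose s' := tri_s s L eps; pose c' := tri_c s c L eps.
pose x' := tri_cross s L eps.
have s'_inj : injective s' by apply: (@tri_s_inj _ _ s c).
have x'_inj : injective x' by apply: (@tri_cross_inj _ _ s c).
have x'_near e : 99 / 100 <= x' e <= 101 / 100 by apply: (@tri_cross_near _ _ s c).
(* [d1] keeps the intervals around the crossings [x' e] disjoint; [d2] ensures that no two new lines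
   meet at distance exactly [d] from some [x' e]. *)
have [d1 d10 H1] := family_gap (fun ef => (x' ef.1 - x' ef.2) / 2).
have [d2 d20 H2] := family_gap
  (fun eij => (c' eij.2.2 - c' eij.2.1) / (s' eij.2.1 - s' eij.2.2) - x' eij.1).
pose d := Num.min (1 / 100) (Num.min d1 d2).
have d0 : 0 < d by rewrite !lt_min d10 d20; lra.
have [dc dd1 dd2] : [/\ d <= 1 / 100, d <= d1 & d <= d2].
  by rewrite !ge_min !lexx !orbT.
have W_inj e x : `|x - x' e| = d -> injective (line s' c' x).
  move=> xd i j; rewrite /line => E; apply/eqP; apply: contraTT dd2 => ij.
  have xE : x = (c' j - c' i) / (s' i - s' j).
    by apply: (canRL (mulfK _)); [rewrite subr_eq0 (inj_eq s'_inj) | lra].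
  have := H2 (e, (i, j)); rewrite /= -xE -normr_gt0 xd => /(_ d0).
  by rewrite -ltNge.
pose zone e := (x' e - d, x' e + d).
(* In order of time: the windows around -1 and 1/2, the individual changes near 1, the window around
   2. The numbers 0, 3/4 and 3/2 separate them. *)
exists s', c', (map (window_pair L (Some false)) ps ++
  map (window_pair L (Some true)) ps ++
  map zone (enum (kru u v s)) ++ map (window_pair L None) ps).
have zone_disj : pairwise (@disj R) (map zone (enum (kru u v s))).
  rewrite pairwise_map; have := enum_uniq (kru u v s); rewrite uniq_pairwise.
  apply: sub_pairwise => e f /= ef; rewrite /disj /=.
  have := H1 (e, f); rewrite /= mulf_eq0 invr_eq0 pnatr_eq0 orbF subr_eq0.
  rewrite (inj_eq x'_inj) => /(_ ef); rewrite ltr_normr => /orP[] H; apply/orP.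
    by right; lra.
  by left; lra.
split=> //.
- apply: (@disj_cat _ 0); first exact: window_disj.
  + apply: (@disj_cat _ (3 / 4)); first exact: window_disj.
    * apply: (@disj_cat _ (3 / 2)) => //; first exact: window_disj.
      - by move=> _ /mapP[e _ ->]; have := x'_near e; rewrite /=; lra.
      - by move=> _ /mapP[p /L_ps/(window_range L0 None) H ->]; lra.
    * by move=> _ /mapP[p /L_ps/(window_range L0 (Some true)) H ->]; lra.
    * move=> p; rewrite mem_cat => /orP[/mapP[e _ ->]|].
        by have := x'_near e; rewrite /=; lra.
      by move=> /mapP[q /L_ps/(window_range L0 None) H ->]; lra.
  + by move=> _ /mapP[p /L_ps/(window_range L0 (Some false)) H ->]; lra.
  + move=> p; rewrite !mem_cat => /or3P[].
    * by move=> /mapP[q /L_ps/(window_range L0 (Some true)) H ->]; lra.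
    * by move=> /mapP[e _ ->]; have := x'_near e; rewrite /=; lra.
    * by move=> /mapP[q /L_ps/(window_range L0 None) H ->]; lra.
- have win o p : p \in ps ->
    kru_changes (tri_u u v) (tri_v v) s' c' (window_pair L o p).
    by move=> pps; apply: window_changes (ps_changes pps) => //; apply: L_ps.
  move=> p; rewrite !mem_cat => /or4P[] /mapP[q Hq ->]; try exact: win.
  rewrite mem_enum in Hq.
  apply: zone_changes => //; apply: (W_inj q); rewrite -/x'.
    by rewrite addrAC subrr add0r normrN gtr0_norm.
  by rewrite addrAC subrr add0r gtr0_norm.
- by rewrite !size_cat !size_map -cardE; lia.
- apply: card_tri_kru => e; apply/eqP => /s'_inj //.
Qed.

End TriangleStep.

(** * Greedy labelling *)

(** The absolute difference: at least one of the truncated subtractions is 0. *)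
Definition dist (a b : nat) : nat := ((a - b) + (b - a))%N.

Definition edge_dist (I V : Type) (u v : I -> V) (lab : V -> nat) (e : I) :=
  dist (lab (u e)) (lab (v e)).

Lemma ex_fresh (s : seq nat) : exists2 x, (x <= size s)%N & x \notin s.
Proof.
have [/allP sub|/allPn[x]] := boolP (all [in s] (iota 0 (size s).+1)).
  by have := uniq_leq_size (iota_uniq _ _) sub; rewrite size_iota ltnn.
by rewrite mem_iota ltnS => xs nx; exists x.
Qed.

Section GreedyLabelling.
Variables (I V : finType) (u v : I -> V) (lab : V -> nat) (N : nat).
Hypothesis uv : forall e, u e != v e.
Hypothesis lab_inj : injective lab.
Hypothesis lab_lt : forall x, (lab x < N)%N.
Hypothesis dist_inj : injective (edge_dist u v lab).
Hypothesis N_large : (#|V| + 13 * #|I| + 1 < N)%N.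

Let dist' lab' := edge_dist (tri_u u v) (tri_v v) lab'.

(** Invariant once the new vertices of the triangles in [es] are labelled: labels and edge lengths
    are distinct among the parts already treated; the other new vertices carry provisional
    labels. *)
Let partial (es : seq I) (lab' : V + I -> nat) :=
  [/\ forall x, lab' (inl x) = lab x, forall x, (lab' x < N)%N,
      {in [pred x | if x is inr e then e \in es else true] &, injective lab'} &
      {in [pred oe | (oe.1 == None) || (oe.2 \in es)] &, injective (dist' lab')}].

Let partial_cons e0 es lab' : partial es lab' ->
  exists lab'', partial (e0 :: es) lab''.
Proof.
move=> [lab'E lab'_lt lab'_inj dist'_inj].
have [e0s|e0s] := boolP (e0 \in es).
  exists lab'; split=> //.
    apply: sub_in2 lab'_inj => -[x //|e].
    by rewrite !inE => /orP[/eqP->|].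
  apply: sub_in2 dist'_inj => -[o e]; rewrite !inE /=.
  by case/or3P=> [->|/eqP->|->] //; rewrite ?e0s orbT.
pose p := lab (u e0); pose q := lab (v e0).
pose D := codom (dist' lab').
(* Forbidden are existing labels, points at an existing length from [p] or [q], and the midpoint,
   where both new edges would be equally long: [|V| + 13 |I| + 1] values in all. *)
have [X Xle] := ex_fresh (codom lab' ++ map (addn p) D ++ map (subn p) D ++
  map (addn q) D ++ map (subn q) D ++ [:: (p + q)./2]).
rewrite !mem_cat !negb_or => /and5P[nl np1 np2 nq1 /andP[nq2 npq]].
rewrite andbT in npq.
have nD (a : nat) i : a = p \/ a = q -> dist a X <> dist' lab' i.
  move=> ap aX.
  have Hi : dist' lab' i \in D by apply: codom_f.
  have := map_f (addn p) Hi; have := map_f (subn p) Hi.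
  have := map_f (addn q) Hi; have := map_f (subn q) Hi; rewrite -aX => m1 m2 m3 m4.
  have [E1|[E1|[E1|E1]]] : X = (p + dist a X)%N \/ X = (p - dist a X)%N \/
      X = (q + dist a X)%N \/ X = (q - dist a X)%N by rewrite /dist; lia.
  - by rewrite -E1 (negPf np1) in m4.
  - by rewrite -E1 (negPf np2) in m3.
  - by rewrite -E1 (negPf nq1) in m2.
  - by rewrite -E1 (negPf nq2) in m1.
have pq : p <> q by move=> /lab_inj/eqP; rewrite (negPf (uv e0)).
have cD : size D = #|{: option bool * I}| by rewrite size_codom.
clearbody D; pose lab'' x := if x == inr e0 then X else lab' x.
have XN : (X < N)%N.
  apply: leq_ltn_trans Xle _; rewrite !size_cat size_codom !size_map cD /=.
  by rewrite card_sum card_prod card_option card_bool; lia.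
exists lab''; split=> [x|x||].
- by rewrite /lab'' /= lab'E.
- by rewrite /lab''; case: ifP.
- have nX x : lab' x <> X by move=> E; case/negP: nl; rewrite -E codom_f.
  move=> x y; rewrite /lab''; have [->|xe] := eqVneq x (inr e0);
    have [->|ye] := eqVneq y (inr e0) => // Hx Hy.
  + by move/esym/nX.
  + by move/nX.
  apply: lab'_inj.
    by case: x xe Hx => // e ee; rewrite !inE => /orP[/eqP E|//]; rewrite E eqxx in ee.
  by case: y ye Hy => // e ee; rewrite !inE => /orP[/eqP E|//]; rewrite E eqxx in ee.
have distE o e : (o == None) || (e != e0) ->
    dist' lab'' (o, e) = dist' lab' (o, e).
  move=> H; rewrite /dist' /edge_dist /lab'' /=; congr dist.
  rewrite /tri_v; case: o H => [d|] //= /negPf ee.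
  by rewrite -[inr _ == _]/(e == e0) ee.
have distN d : dist' lab'' (Some d, e0) = dist (if d then q else p) X.
  by rewrite /dist' /edge_dist /lab'' /tri_u /tri_v /= eqxx lab'E; case: d.
have nDd d i : dist (if d then q else p) X <> dist' lab' i.
  by apply: nD; case: d; [right|left].
have old o e : ~~ ((o == None) || (e != e0)) -> exists d, (o, e) = (Some d, e0).
  by case: o => [d|] //= /negPn/eqP->; exists d.
move=> [o e] [o' f] He Hf.
have [H1|/old[d [-> ->]]] := boolP ((o == None) || (e != e0));
  have [H2|/old[d' [-> ->]]] := boolP ((o' == None) || (f != e0)).
- rewrite !distE //; apply: dist'_inj; move: He Hf H1 H2; rewrite !inE /=.
    by case: (o == None) => //=; case: (e == e0).
  by case: (o' == None) => //=; case: (f == e0).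
- by rewrite distE // distN => /esym/nDd.
- by rewrite distN distE // => /nDd.
rewrite !distN => E; have [-> //|dd'] := eqVneq d d'; exfalso.
by case/negP: npq; case: d d' dd' E => [] [] // _; rewrite /dist; lia.
Qed.

Lemma greedy_labelling : exists lab' : V + I -> nat,
  [/\ injective lab', forall x, (lab' x < N)%N &
      injective (edge_dist (tri_u u v) (tri_v v) lab')].
Proof.
have [lab' [_ lt' inj' d_inj']] : exists lab', partial (enum I) lab'.
  elim: (enum I) => [|e0 es [lab']]; last exact: partial_cons.
  exists (fun x => if x is inl y then lab y else 0%N); split=> //.
  - by case=> //= _; apply: leq_ltn_trans N_large.
  - by move=> [x|//] [y|//] _ _ /lab_inj->.
  by move=> [[d|] e] [[d'|] f]; rewrite !inE //= => _ _ /(@dist_inj e f)->.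
exists lab'; split=> // x y.
  by apply: inj'; rewrite inE; case: x y => [?|?] [?|?] //; rewrite mem_enum.
by apply: d_inj'; rewrite inE mem_enum orbT.
Qed.

End GreedyLabelling.

(** The induction also carries [|V| <= 3^i + 1], which leaves room for the labels, and a tree
    ordered by slope with at least a third of the edges. If [a] is the number of changes, the next
    one is at least [3a + 3^i / 3], hence the growth like [i * 3^i]. *)
Lemma triangle_graph (R : realType) i :
  exists (I V : finType) (u v : I -> V) (lab : V -> nat) (s c : I -> R)
         (ps : seq (R * R)),
  [/\ #|I| = (3 ^ i)%N,
      [/\ injective lab, forall x, (lab x < 6 * 3 ^ i)%N,
          injective (edge_dist u v lab) & forall e, u e != v e],
      pairwise (@disj R) ps,
      forall p, p \in ps -> kru_changes u v s c p &
      (i * 3 ^ i <= 9 * size ps)%N].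
Proof.
suff [I [V [u [v [lab [s [c [ps [H1 H2 H3 [H4 H5 H6] _]]]]]]]]] :
  exists (I V : finType) (u v : I -> V) (lab : V -> nat) (s c : I -> R)
         (ps : seq (R * R)),
  [/\ #|I| = (3 ^ i)%N, (#|V| <= 3 ^ i + 1)%N,
      [/\ injective lab, forall x, (lab x < 6 * 3 ^ i)%N,
          injective (edge_dist u v lab) & forall e, u e != v e],
      [/\ pairwise (@disj R) ps,
      forall p, p \in ps -> kru_changes u v s c p &
      (i * 3 ^ i <= 9 * size ps)%N] &
      injective s /\ (3 ^ i <= 3 * #|kru u v s|)%N].
  by exists I, V, u, v, lab, s, c, ps.
elim: i => [|i [I [V [u [v [lab [s [c [ps [cI cV [l_inj l_lt d_inj uv]
    [dps Hps szps] [s_inj cK]]]]]]]]]]].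
  exists unit, bool, (fun=> false), (fun=> true), nat_of_bool, (fun=> 0),
    (fun=> 0), [::]; split; rewrite ?card_unit ?card_bool //; split=> //.
  - by move=> [] [].
  - by case.
  - by move=> [] [].
  - by move=> [] [].
  - rewrite (_ : kru _ _ _ = setT) ?cardsT ?card_unit //; apply/setP => e.
    rewrite [RHS]inE; apply/kruP; exists id => // f.
    by rewrite ltxx.
have [s' [c' [ps' [s'_inj dps' Hps' szps' cK']]]] := triangle_step s_inj dps Hps.
have [x||lab' [l'_inj l'_lt d'_inj]] :=
  @greedy_labelling I V u v lab (6 * 3 ^ i.+1) uv l_inj _ d_inj.
- by apply: leq_trans (l_lt x) _; rewrite expnS; lia.
- by rewrite cI expnS; have := expn_gt0 3 i; lia.
exists (option bool * I)%type, (V + I)%type, (tri_u u v), (tri_v v), lab', s', c', ps'.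
split.
- by rewrite card_prod card_option card_bool cI expnS.
- by rewrite card_sum cI expnS; lia.
- split=> // -[[d|] e]; rewrite /tri_u /tri_v //=.
  exact: uv.
- split=> //; rewrite szps' expnS; nia.
by split=> //; rewrite expnS -cI leq_mul2l.
Qed.

(** * Packing edge-disjoint copies *)

Lemma ex_subset_card (T : finType) (A B : {set T}) m : A \subset B ->
  (#|A| <= m <= #|B|)%N -> exists E : {set T}, [/\ A \subset E, E \subset B & #|E| = m].
Proof.
move=> AB /andP[Am mB]; have [d dE] : exists d, (m = #|A| + d)%N.
  by exists (m - #|A|)%N; rewrite subnKC.
elim: d A AB Am dE => [|d IH] A AB Am dE.
  by exists A; split=> //; rewrite dE addn0.
have /properP[_ [x xB xA]] : A \proper B.
  by rewrite properEcard AB; lia.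
have cA : #|x |: A| = #|A|.+1 by rewrite cardsU1 xA.
have [|||E [AE EB Em]] := IH (x |: A).
- by apply/subsetP => y; rewrite !inE => /orP[/eqP->|/(subsetP AB)].
- by rewrite cA; lia.
- by rewrite cA dE addnS.
by exists E; split=> //; apply: subset_trans AE; apply: subsetU1.
Qed.

(** Added to the copies to make the packed graph connected. *)
Definition star n : {set {set 'I_n.+1}} := [set [set ord0; lift ord0 z] | z : 'I_n].

Lemma star_connected n (E : {set {set 'I_n.+1}}) :
  star n \subset E -> connected_graph E.
Proof.
move=> sE; have c0 y : connect (adjacent E) ord0 y.
  have [->|y0] := eqVneq y ord0; first exact: connect0.
  have [z ->|] := unliftP ord0 y; last by move=> y0'; rewrite y0' eqxx in y0.
  apply: connect1; apply/andP; split; first exact: neq_lift.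
  by apply: (subsetP sE); apply/imsetP; exists z.
move=> x y; apply: connect_trans (c0 y).
by rewrite (sym_connect_sym (@adjacent_sym _ E)).
Qed.

Section PackedGraph.
Variables (R : realType) (I V : finType) (u v : I -> V) (lab : V -> nat).
Variables (s c : I -> R) (ps : seq (R * R)) (N k n m : nat).
Hypothesis lab_inj : injective lab.
Hypothesis lab_lt : forall x, (lab x < N)%N.
Hypothesis dist_inj : injective (edge_dist u v lab).
Hypothesis uv : forall e, u e != v e.
Hypothesis ps_disj : pairwise (@disj R) ps.
Hypothesis ps_changes : forall p, p \in ps -> kru_changes u v s c p.
Hypothesis labels_fit : (0 < k)%N -> (N + k <= n.+1)%N.
Hypothesis m_bounds : (#|I| * k + n <= m <= 'C(n.+1, 2))%N.

Definition shift_lab (j : 'I_k) (x : V) : 'I_n.+1 := inord (lab x + j).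
Definition copy (ej : I * 'I_k) : {set 'I_n.+1} :=
  [set shift_lab ej.2 (u ej.1); shift_lab ej.2 (v ej.1)].

Let shift_labE j x : shift_lab j x = (lab x + j)%N :> nat.
Proof.
have k0 : (0 < k)%N by apply: leq_trans (ltn_ord j).
rewrite inordK //; have := lab_lt x; have := labels_fit k0; have := ltn_ord j.
lia.
Qed.

Let shift_lab_inj j : injective (shift_lab j).
Proof. by move=> x y /(congr1 val); rewrite /= !shift_labE => /addIn/lab_inj. Qed.

(** Translation preserves the length, which determines [e]; the position of the ends then determines
    [j]. *)
Lemma copy_inj : injective copy.
Proof.
move=> [e j] [f j'] E.
have E1 : shift_lab j (u e) \in copy (f, j') by rewrite -E !inE eqxx.
have E2 : shift_lab j (v e) \in copy (f, j') by rewrite -E !inE eqxx orbT.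
have E3 : shift_lab j' (u f) \in copy (e, j) by rewrite E !inE eqxx.
have E4 : shift_lab j' (v f) \in copy (e, j) by rewrite E !inE eqxx orbT.
move: E1 E2 E3 E4; rewrite !inE -!val_eqE /= !shift_labE => E1 E2 E3 E4.
have ef : e = f by apply: dist_inj; rewrite /edge_dist /dist; lia.
rewrite -{}ef in E1 E2 E3 E4 *; congr (_, _); apply/val_inj => /=.
have : lab (u e) <> lab (v e) by move/lab_inj/eqP; rewrite (negPf (uv e)).
lia.
Qed.

Let card_copy ej : #|copy ej| = 2%N.
Proof. by rewrite cards2 (inj_eq (@shift_lab_inj _)) uv. Qed.

(** The copies and the star have at most [m] edges together; arbitrary further pairs bring the
    number to [m]. *)
Let edge_set : exists E : {set {set 'I_n.+1}},
  [/\ copy @: [set: I * 'I_k] \subset E, forall e, e \in E -> #|e| = 2%N,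
      connected_graph E & #|E| = m].
Proof.
have [||E [AE EB Em]] := @ex_subset_card _ (copy @: [set: I * 'I_k] :|: star n)
  [set e : {set 'I_n.+1} | #|e| == 2%N] m.
- apply/subsetP => e; rewrite !inE => /orP[/imsetP[ej _ ->]|/imsetP[z _ ->]].
    by rewrite card_copy.
  by rewrite cards2 neq_lift.
- rewrite card_draws card_ord; case/andP: m_bounds => mk ->; rewrite andbT.
  apply: leq_trans mk; apply: leq_trans (leq_card_setU _ _) _; apply: leq_add.
    by rewrite (card_imset _ copy_inj) cardsT card_prod card_ord.
  by apply: leq_trans (leq_imset_card _ _) _; rewrite card_ord.
exists E; split=> //.
- exact: subset_trans (subsetUl _ _) AE.
- by move=> e /(subsetP EB); rewrite inE => /eqP.
- exact/star_connected/(subset_trans (subsetUr _ _) AE).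
Qed.

Section Weights.
Variables (L eps : R).
Hypotheses (L0 : 0 < L) (eps0 : 0 < eps).
Hypothesis ps_range : forall p, p \in ps -> `|p.1| <= L /\ `|p.2| <= L.
Hypothesis eps_small :
  forall e (y : R), `|y| <= k%:R + 1 -> `|eps * line s c (8 * L * y) e| <= 1 / 100.

(* The lines of the j-th copy are small perturbations of the tangent to -x^2 at j, so
   near j this copy is lighter than everything else. *)
Definition copy_slope (ej : I * 'I_k) : R := - 2 * ej.2%:R + eps * (8 * L) * s ej.1.
Definition copy_icpt (ej : I * 'I_k) : R :=
  ej.2%:R ^+ 2 + eps * (c ej.1 - 8 * L * ej.2%:R * s ej.1).

(** Edges outside the copies get the constant weight [k + 3], above the active copy at all the times
    considered. *)
Definition pack_slope (e : {set 'I_n.+1}) : R :=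
  if [pick ej | copy ej == e] is Some ej then copy_slope ej else 0.
Definition pack_icpt (e : {set 'I_n.+1}) : R :=
  if [pick ej | copy ej == e] is Some ej then copy_icpt ej else k%:R + 3.

Variables (E : {set {set 'I_n.+1}}).
Hypothesis copyE : copy @: [set: I * 'I_k] \subset E.
Hypothesis E_card2 : forall e, e \in E -> #|e| = 2%N.
Hypothesis E_connected : connected_graph E.

Definition packed : pwgraph R n.+1 :=
  PWGraph E_card2 E_connected pack_slope pack_icpt.

Let packed_copy x ej :
  edge_weight packed x (copy ej) = line copy_slope copy_icpt x ej.
Proof.
rewrite /edge_weight /= /pack_slope /pack_icpt /line; case: pickP => [ej'|/(_ ej)].
  by move=> /eqP/copy_inj->.
by rewrite eqxx.
Qed.

Let time (j : 'I_k) (t : R) : R := j%:R + t / (8 * L).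

Let time_bound t : `|t| <= L -> - (1 / 8) <= t / (8 * L) <= 1 / 8.
Proof.
have K0 : 0 < 8 * L by rewrite mulr_gt0.
by rewrite ler_norml => /andP[t1 t2]; rewrite ler_pdivlMr // ler_pdivrMr //; lra.
Qed.

Let copy_line j t f (i : 'I_k) : line copy_slope copy_icpt (time j t) (f, i) =
  - 2 * i%:R * time j t + i%:R ^+ 2 +
  eps * line s c (8 * L * (time j t - i%:R)) f.
Proof. by rewrite /line /copy_slope /copy_icpt /=; ring. Qed.

Let own_line j t f : line copy_slope copy_icpt (time j t) (f, j) =
  - 2 * j%:R * time j t + j%:R ^+ 2 + eps * line s c t f.
Proof.
rewrite copy_line; congr (_ + eps * line s c _ f); rewrite /time addrAC subrr add0r.
by rewrite mulrC divfK // mulf_neq0 // ?pnatr_eq0 // lt0r_neq0.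
Qed.

Let ord_range (j : 'I_k) : 0 <= (j%:R : R) <= k%:R - 1.
Proof.
by rewrite ler0n /= lerBrDr natr1 ler_nat.
Qed.

Let pert_small j t f (i : 'I_k) : `|t| <= L ->
  - (1 / 100) <= eps * line s c (8 * L * (time j t - i%:R)) f <= 1 / 100.
Proof.
move=> /time_bound Ht; rewrite -ler_norml; apply: eps_small; rewrite /time ler_norml.
by have := ord_range i; have := ord_range j; lra.
Qed.

Let light_copy j t e A : `|t| <= L ->
  edge_weight packed (time j t) A <= edge_weight packed (time j t) (copy (e, j)) ->
  exists f, A = copy (f, j).
Proof.
move=> Ht; rewrite packed_copy copy_line.
have He := pert_small j e j Ht; have Hj := ord_range j; have H8 := time_bound Ht.
rewrite /edge_weight /= /pack_slope /pack_icpt; case: pickP => [[f i] /eqP <-|_].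
  have [->|ij] := eqVneq i j; first by exists f.
  rewrite -[_ * _ + _]/(line copy_slope copy_icpt _ _) copy_line.
  have Hf := pert_small j f i Ht; move: He Hf.
  move: (eps * _) (eps * _) => a b; rewrite /time => Ha Hb le; exfalso.
  have H : (i%:R + 1 <= j%:R :> R) || (j%:R + 1 <= i%:R :> R).
    by rewrite !natr1 !ler_nat -neq_ltn.
  move: (t / _) H8 le => y H8 le.
  (* The left side is the gap at [j + y] between the tangents at [i] and [j]; it is at least 3/4
     since [i] and [j] differ by at least 1 and [|y|] is at most 1/8. *)
  have {}le : (i%:R - j%:R) * (i%:R - j%:R - 2 * y) <= 1 / 50 by lra.
  by case/orP: H => H; nra.
move: He; move: (eps * _) => a; rewrite /time => Ha le; exfalso.
by move: (t / _) H8 le => y H8 le; nra.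
Qed.

(** Cuts of the packed graph restrict to the copy. Conversely, a cut of the copy extends to all
    vertices: only edges of the active copy are light enough to matter. *)
Let packed_mst j t T e : `|t| <= L -> injective (line s c t) ->
  minimum_spanning_tree packed (time j t) T ->
  (copy (e, j) \in T) = (e \in kru u v (line s c t)).
Proof.
move=> Ht inj mT.
have copyM ej : copy ej \in E by apply: (subsetP copyE); apply: imset_f.
have own f f' : (edge_weight packed (time j t) (copy (f, j)) <
    edge_weight packed (time j t) (copy (f', j))) = (line s c t f < line s c t f').
  by rewrite !packed_copy !own_line ltrD2l ltr_pM2l.
apply/idP/kruP => [eT|[chi H ce]].
  have [X Xe XF] := mst_mem mT eT.
  exists (X \o shift_lab j) => [f lt|]; last by rewrite /copy flip2 in Xe.
  have := XF (copy (f, j)) (copyM _); rewrite own lt /copy flip2 => /(_ isT).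
  by rewrite negbK => /eqP.
(* Vertices outside the copy get the colour [false]. *)
pose X y := if [pick x | shift_lab j x == y] is Some x then chi x else false.
have XE x : X (shift_lab j x) = chi x.
  rewrite /X; case: pickP => [x' /eqP/shift_lab_inj-> //|/(_ x)].
  by rewrite eqxx.
have flipX f : flip X (copy (f, j)) = (chi (u f) != chi (v f)).
  by rewrite /copy flip2 !XE.
apply/negPn/negP => eT.
have [|A [AE Ae XA le]] := mst_notin mT (copyM _) eT (chi := X).
  by rewrite flipX.
have [f Af] := light_copy Ht le; rewrite Af in Ae XA le.
move: XA; rewrite flipX H ?eqxx // lt_neqAle (inj_eq inj).
apply/andP; split; first by apply: contraNneq Ae => ->.
by move: le; rewrite leNgt own -leNgt.
Qed.

Lemma packed_trees : exists Ts : seq {set {set 'I_n.+1}},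
  parametric_mst_sequence packed Ts /\
  (maxn 1 (k * size ps) <= size (undup Ts))%N.
Proof.
have [qs [dqs sqs Hqs]] : exists qs : seq (R * R), [/\ pairwise (@disj R) qs,
    size qs = (k * size ps)%N & forall q, q \in qs ->
    exists (j : 'I_k) p, [/\ (j < k)%N, p \in ps & q = (time j p.1, time j p.2)]].
  suff : forall k', (k' <= k)%N -> exists qs : seq (R * R), [/\ pairwise (@disj R) qs,
    size qs = (k' * size ps)%N & forall q, q \in qs ->
    exists (j : 'I_k) p, [/\ (j < k')%N, p \in ps & q = (time j p.1, time j p.2)]].
    by apply.
  elim=> [_|k' IH lt]; first by exists [::].
  have [qs [dqs sqs Hqs]] := IH (ltnW lt).
  pose j := Ordinal lt.
  exists (qs ++ [seq (time j p.1, time j p.2) | p <- ps]); split.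
  (* The changes of the copy [j] happen within 1/8 of [j]. *)
  - apply: (@disj_cat _ (k'%:R - 1 / 2)) => //.
    + rewrite pairwise_map; apply: sub_pairwise ps_disj => p q.
      by rewrite /disj /= /time !lerD2l !ler_pM2r // invr_gt0 mulr_gt0.
    + move=> _ /Hqs[i [p [ik /ps_range[_ /time_bound H] ->]]] /=.
      have : (i.+1%:R : R) <= k'%:R by rewrite ler_nat.
      by rewrite -natr1 /time; lra.
    + by move=> _ /mapP[p /ps_range[/time_bound H _] ->]; rewrite /time /=; lra.
  - by rewrite size_cat size_map sqs mulSn addnC.
  - move=> q; rewrite mem_cat => /orP[/Hqs[i [p [ik pps ->]]]|/mapP[p pps ->]].
      by exists i, p; rewrite ltnS ltnW.
    by exists j, p; rewrite ltnSn.
rewrite -sqs; apply: mst_count => // q /Hqs[j [p [_ pps ->]]] /=.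
have [p12 i1 i2 nK] := ps_changes pps; have [r1 r2] := ps_range pps.
split=> [|T m1 m2].
  by rewrite /time ltrD2l ltr_pM2r // invr_gt0 mulr_gt0.
apply: nK; apply/setP => e.
by rewrite -(packed_mst e r1 i1 m1) -(packed_mst e r2 i2 m2).
Qed.

End Weights.

Lemma packed_graph : exists G : pwgraph R n.+1, #|edges G| = m /\
  exists Ts : seq {set {set 'I_n.+1}}, parametric_mst_sequence G Ts /\
  (maxn 1 (k * size ps) <= size (undup Ts))%N.
Proof.
have [E [copyE E2 cE Em]] := edge_set.
have [L L0 HL] := pairs_bound ps.
have [B B0 HB] := family_bound (fun e => `|s e| * (8 * L * (k%:R + 1)) + `|c e|).
pose eps := (100 * B)^-1.
have eps0 : 0 < eps by rewrite invr_gt0 mulr_gt0.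
have eps_small e (y : R) :
    `|y| <= k%:R + 1 -> `|eps * line s c (8 * L * y) e| <= 1 / 100.
  move=> yk; have -> : 1 / 100 = eps * B by rewrite /eps; field; apply: lt0r_neq0.
  rewrite normrM gtr0_norm // ler_pM2l //.
  apply: le_trans (HB e); apply: le_trans (ler_norm _).
  apply: le_trans (ler_normD _ _) _; rewrite lerD2r normrM ler_wpM2l //.
  by rewrite normrM gtr0_norm ?mulr_gt0 // ler_pM2l // mulr_gt0.
exists (packed L eps E2 cE); split=> //.
exact: packed_trees.
Qed.

End PackedGraph.

(** * The bound *)

(** [k] is limited by half of the vertices, the labels taking at most the other half, and by the
    edges left after the star. In the first case [m] is bounded by the binomial coefficient, in the
    second the copies use a constant fraction of the edges. *)
Lemma copies_count n m i : (12 * 3 ^ i <= n.+1)%N -> (n.+1 < 36 * 3 ^ i)%N ->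
  (2 * n.+1 <= m + 3)%N -> (m <= 'C(n.+1, 2))%N ->
  exists k, [/\ (6 * 3 ^ i + k <= n.+1)%N, (3 ^ i * k + n <= m)%N &
               (m <= 36 * (k * 3 ^ i))%N].
Proof.
set t := (3 ^ i)%N => tn nt mn mC.
have t0 : (0 < t)%N by rewrite expn_gt0.
have {}mC : (2 * m <= n.+1 * n)%N.
  by move: mC; rewrite bin2 /=; move: (n.+1 * n)%N => z; lia.
exists (minn (n.+1)./2 ((m - n) %/ t)).
have := leq_divM (m - n) t; have := ltn_ceil (m - n) t0.
rewrite mulSn; set q := ((m - n) %/ t)%N => q1 q2.
rewrite /minn; case: ltnP => H; split; try lia.
- have : ((n.+1)./2 * t <= q * t)%N by rewrite leq_mul2r ltnW ?orbT.
  lia.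
- have : (n <= 2 * (n.+1)./2)%N by lia.
  nia.
Qed.

Lemma ln_le_exp3 (R : realType) n i : (0 < n)%N -> (n <= 3 ^ i)%N ->
  ln (n%:R : R) <= 2 * i%:R.
Proof.
move=> n0 ni.
have n0R : 0 < n%:R :> R by rewrite ltr0n.
have : ln n%:R <= ln (3 ^+ i) :> R.
  by rewrite ler_ln ?posrE ?exprn_gt0 // -natrX ler_nat.
move/le_trans; apply.
have l3 : ln 3 <= 2 :> R.
  have -> : 3 = 1 + 2 :> R by ring.
  by apply: le_ln1Dx; lra.
by rewrite lnXn // -[leLHS]mulr_natr ler_wpM2r.
Qed.

Theorem theorem5 (R : realType) :
  exists2 C : R, 0 < C &
    forall n m : nat, (0 < n)%N -> (2 * n <= m + 3)%N -> (m <= 'C(n, 2))%N ->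
    exists G : pwgraph R n,
      #|edges G| = m /\
      exists Ts : seq {set {set 'I_n}},
        parametric_mst_sequence G Ts /\
        C * m%:R * ln (n%:R : R) <= (size (undup Ts))%:R.
Proof.
have C0 : 0 < 72 * 72 :> R by rewrite mulr_gt0.
exists ((72 * 72)^-1) => [|[//|n] m _ mn mC]; first by rewrite invr_gt0.
(* For few vertices no copy is packed and one tree suffices: [m] is at most 630 and the logarithm at
   most 8, with product 5040 below [72 * 72]. *)
have [n36|n36] := ltnP n.+1 36.
  have [I [V [u [v [lab [s [c [ps [cI [l_inj l_lt d_inj uv] dps Hps _]]]]]]]]] :=
    triangle_graph R 0.
  have [||G [Gm [Ts [sTs szTs]]]] := @packed_graph R I V u v lab s c ps _ 0 n m
    l_inj l_lt d_inj uv dps Hps.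
  - by [].
  - by rewrite muln0 mC andbT; lia.
  exists G; split=> //; exists Ts; split=> //.
  have sz1 : 1 <= (size (undup Ts))%:R :> R.
    by rewrite ler1n; apply: leq_trans szTs; apply: leq_maxl.
  apply: le_trans sz1.
  have n0 : 0 < n.+1%:R :> R by rewrite ltr0n.
  have l0 : 0 <= ln (n.+1%:R : R) by rewrite ln_ge0 // ler1n.
  have l36 : ln (n.+1%:R : R) <= 2 * 4%:R by apply: ln_le_exp3 => //; lia.
  have m_le : m%:R <= 70 * 9 :> R.
    rewrite -natrM ler_nat (leq_trans mC) //.
    exact: leq_trans (leq_bin2l 2 (ltnW n36)) _.
  have m0 : 0 <= m%:R :> R by rewrite ler0n.
  rewrite -mulrA ler_pdivrMl // mulr1.
  by apply: le_trans (ler_pM m0 l0 m_le l36) _; lra.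
(* The largest [i] with [12 * 3^i <= n.+1]; it is positive as there are at least 36 vertices. *)
pose i := trunc_log 3 (n.+1 %/ 12).
have /andP[i1 i2] : (3 ^ i <= n.+1 %/ 12 < 3 ^ i.+1)%N.
  by apply: trunc_log_bounds => //; lia.
have i0 : (0 < i)%N by rewrite lt0n; apply/eqP => E; move: i2; rewrite E; lia.
have H1 : (12 * 3 ^ i <= n.+1)%N by lia.
have H2 : (n.+1 < 36 * 3 ^ i)%N by rewrite expnS in i2; lia.
have [k [k1 k2 k3]] := copies_count H1 H2 mn mC.
have [I [V [u [v [lab [s [c [ps [cI [l_inj l_lt d_inj uv] dps Hps szps]]]]]]]]] :=
  triangle_graph R i.
have [||G [Gm [Ts [sTs szTs]]]] := @packed_graph R I V u v lab s c ps _ k n m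
  l_inj l_lt d_inj uv dps Hps.
- by [].
- by rewrite cI k2.
exists G; split=> //; exists Ts; split=> //.
(* The factor is [36 * 9], from [copies_count] and [triangle_graph]. With the logarithm at most
   [10 * i], the total 3240 is below [72 * 72]. *)
have {}szTs : (m * i <= 324 * size (undup Ts))%N.
  have : (k * size ps <= size (undup Ts))%N.
    by apply: leq_trans szTs; apply: leq_maxr.
  have := leq_mul2l k (i * 3 ^ i) (9 * size ps); rewrite szps orbT => /idP.
  have := leq_mul2r i m (36 * (k * 3 ^ i)); rewrite k3 orbT => /idP.
  lia.
have l_le : ln (n.+1%:R : R) <= 2 * (i + 4)%:R.
  by apply: ln_le_exp3 => //; rewrite expnD; lia.
have i1R : 1 <= i%:R :> R by rewrite ler1n.
have m0 : 0 <= m%:R :> R by rewrite ler0n.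
have {}szTs : m%:R * i%:R <= 324 * (size (undup Ts))%:R :> R.
  by rewrite -!natrM ler_nat.
rewrite natrD in l_le.
have l_le' : ln (n.+1%:R : R) <= 10 * i%:R by lra.
rewrite -mulrA ler_pdivrMl //; have := ler_wpM2l m0 l_le'.
have := ler0n R (size (undup Ts)); lra.
Qed.
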